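(* Let $n\ge 2$, let $S\subseteq D_n$ be non-empty with $1\notin S$ and $S=S^{-1}$, let $A$ be the adjacency matrix of $\mathrm{Cay}(D_n,S)$, and let $1\le h\le\lfloor (n-1)/2\rfloor$. The eigenvalues of $A$ corresponding to the representation $\rho_h$ are $$\lambda_h^{(1)}=\eta_h(S_1)+\sqrt{\eta_h(S_2)\eta_h(S_2^{-1})}\quad\text{and}\quad \lambda_h^{(2)}=\eta_h(S_1)-\sqrt{\eta_h(S_2)\eta_h(S_2^{-1})},$$ each of multiplicity $2$ (counted in the $4$-dimensional space $V_{\rho_h}$). Moreover, the corresponding eigenvectors in $V_{\rho_h}$ are given as follows (in each case the listed vectors span the eigenspace in $V_{\rho_h}$). (i) If $\eta_h(S_2)=0$, then the normalized eigenvectors corresponding to $\lambda_h:=\eta_h(S_1)$ are $$u_h^{(1)}=\tfrac{1}{\sqrt n}\left(\{\omega_n^{hk}\}_{k=0}^{n-1},\mathbf{0}_n\right)^t,\quad u_h^{(2)}=\tfrac{1}{\sqrt n}\left(\mathbf{0}_n,\{\omega_n^{hk}\}_{k=0}^{n-1}\right)^t,$$ $$u_h^{(3)}=\tfrac{1}{\sqrt n}\left(\mathbf{0}_n,\{\omega_n^{-hk}\}_{k=0}^{n-1}\right)^t,\quad u_h^{(4)}=\tfrac{1}{\sqrt n}\left(\{\omega_n^{-hk}\}_{k=0}^{n-1},\mathbf{0}_n\right)^t.$$ (ii) If $\eta_h(S_2)\ne 0$, let $\ell_h=\sqrt{\eta_h(S_2^{-1})/\eta_h(S_2)}$, the square root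 being chosen so that $\ell_h\,\eta_h(S_2)=\sqrt{\eta_h(S_2)\eta_h(S_2^{-1})}$. Then the normalized eigenvectors corresponding to $\lambda_h^{(1)}$ are $$v_h^{(1)}=\tfrac{1}{\sqrt{2n}}\left(\bar\ell_h,\bar\ell_h\omega_n^{h},\ldots,\bar\ell_h\omega_n^{(n-1)h},1,\omega_n^{h},\ldots,\omega_n^{(n-1)h}\right)^t,$$ $$v_h^{(2)}=\tfrac{1}{\sqrt{2n}}\left(1,\omega_n^{-h},\ldots,\omega_n^{-(n-1)h},\bar\ell_h,\bar\ell_h\omega_n^{-h},\ldots,\bar\ell_h\omega_n^{-(n-1)h}\right)^t,$$ and the normalized eigenvectors corresponding to $\lambda_h^{(2)}$ are $$v_h^{(3)}=\tfrac{1}{\sqrt{2n}}\left(-1,-\omega_n^{h},\ldots,-\omega_n^{(n-1)h},\ell_h,\ell_h\omega_n^{h},\ldots,\ell_h\omega_n^{(n-1)h}\right)^t,$$ $$v_h^{(4)}=\tfrac{1}{\sqrt{2n}}\left(\ell_h,\ell_h\omega_n^{-h},\ldots,\ell_h\omega_n^{-(n-1)h},-1,-\omega_n^{-h},\ldots,-\omega_n^{-(n-1)h}\right)^t.$$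
   Context: $D_n=\langle a,b: a^n=1=b^2,\ bab=a^{-1}\rangle$ is the dihedral group of order $2n$; $\omega_n=e^{2\pi\sqrt{-1}/n}$. For a finite group $\Gamma$ and non-empty $S\subseteq\Gamma$ with $1\notin S=S^{-1}$, the Cayley graph $\mathrm{Cay}(\Gamma,S)$ has vertex set $\Gamma$ and edges $\{u,v\}$ with $uv^{-1}\in S$. Rows and columns of $A$ and entries of vectors are ordered as $1,a,\ldots,a^{n-1},b,ba,\ldots,ba^{n-1}$. $\rho_h$ is the two-dimensional irreducible representation $\rho_h(a^k)=\begin{pmatrix}\omega_n^{hk}&0\\0&\omega_n^{-hk}\end{pmatrix}$, $\rho_h(ba^k)=\begin{pmatrix}0&\omega_n^{-hk}\\ \omega_n^{hk}&0\end{pmatrix}$, $0\le k\le n-1$. Let $V_{\rho_h}\subseteq\mathbb{C}^{D_n}$ be the ($4$-dimensional, $A$-invariant) span of the matrix coefficients of $\rho_h$; eigenvalues/eigenvectors of $A$ corresponding to $\rho_h$ are those of the restriction of $A$ to $V_{\rho_h}$. $S_1=S\cap\langle a\rangle$, $S_2=bS\cap\langle a\rangle$ with $bS=\{bs:s\in S\}$, and $S_2^{-1}=\{x^{-1}:x\in S_2\}$. For $C\subseteq\langle a\rangle$, $C^*=\{k\in\mathbb{Z}_n:a^k\in C\}$ and $\eta_h(C)=\sum_{k\in C^*}\omega_n^{hk}$, with $\eta_h(\emptyset)=0$. Note $\eta_h(S_2^{-1})=\overline{\eta_h(S_2)}$, so $\eta_h(S_2)\eta_h(S_2^{-1})\ge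 0$, and $\sqrt{\eta_h(S_2)\eta_h(S_2^{-1})}$ denotes the non-negative square root. $\mathbf{0}_n$ is the zero row vector of length $n$, $\{z_k\}_{k=0}^{n-1}$ is the row vector $(z_0,\ldots,z_{n-1})$, and the bar is complex conjugation. *)

(* Defs.v *)
From HB Require Import structures.
From mathcomp Require Import all_boot all_order all_algebra.
From mathcomp Require Import all_fingroup all_solvable.
From mathcomp Require Import complex.
From mathcomp Require Import reals trigo.

Set Implicit Arguments.
Unset Strict Implicit.
Unset Printing Implicit Defensive.

Import Order.TTheory GRing.Theory Num.Theory.

Local Open Scope ring_scope.

Section CayleyGraph.
Local Open Scope group_scope.

Definition cayley_rel (gT : finGroupType) (S : {set gT}) : rel gT :=
  fun u v => u * v^-1 \in S.

End CayleyGraph.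

Definition adjacency_mx (F : nzRingType) (T : Type) (m : nat) (x : 'I_m -> T)
    (e : rel T) : 'M[F]_m :=
  \matrix_(i, j) (e (x i) (x j))%:R.

Section DihedralGroup.
Local Open Scope group_scope.

(* For n >= 2, the library group 'D_(n.*2) has order 2n and the presentation
   <x, y | x^n = y^2 = 1, x^y = x^-1> (card_dihedral, Grp_dihedral), so any
   generating pair that satisfies these relations is the image of (x, y) under
   an automorphism. *)
Definition dihedral_generators (n : nat) (a b : 'D_(n.*2)) : Prop :=
  [/\ <<[set a; b]>> = [set: 'D_(n.*2)], a ^+ n = 1, b ^+ 2 = 1
    & b * a * b = a^-1].

Lemma dihedral_generators_ex (n : nat) :
  (1 < n)%N -> exists a b : 'D_(n.*2), dihedral_generators a b.
Proof.
move=> n_gt1; have := isoGrp_hom (Grp_dihedral n_gt1).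
case/existsP=> -[x y] /=; rewrite !xpair_eqE.
case/and4P=> /eqP gen /eqP xn /eqP y2 /eqP xy.
exists x, y; split=> //.
  by rewrite -gen joing_idl joing_idr.
have yV : y^-1 = y by apply/eqP; rewrite eq_invg_mul -expg2 y2.
by rewrite -xy conjgE yV mulgA.
Qed.

(* The ordering 1, a, ..., a^(n-1), b, ba, ..., ba^(n-1). *)
Definition dihedral_elt (gT : finGroupType) (n : nat) (a b : gT)
    (i : 'I_(n + n)) : gT :=
  match split i with
  | inl k => a ^+ k
  | inr k => b * a ^+ k
  end.

Definition rot_part (gT : finGroupType) (a : gT) (S : {set gT}) : {set gT} :=
  S :&: <[a]>.

Definition refl_part (gT : finGroupType) (a b : gT) (S : {set gT}) : {set gT} :=
  (b *: S) :&: <[a]>.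

End DihedralGroup.

Section Complex.
Variable R : realType.
Local Open Scope complex_scope.

(* e^(2 pi i / n) *)
Definition omega (n : nat) : R[i] :=
  cos (2 * pi / n%:R) +i* sin (2 * pi / n%:R).

(* k ranges over the representatives 0, ..., n-1 of Z_n *)
Definition eta_sum (gT : finGroupType) (n : nat) (a : gT) (h : nat) (C : {set gT}) :
    R[i] :=
  \sum_(k < n | (a ^+ k)%g \in C) omega n ^+ (h * k).

Definition mx2 (x00 x01 x10 x11 : R[i]) : 'M[R[i]]_2 :=
  block_mx (x00%:M : 'M_1) (x01%:M : 'M_1) (x10%:M : 'M_1) (x11%:M : 'M_1).

Definition rho (gT : finGroupType) (n : nat) (a b : gT) (h : nat) (g : gT) :
    'M[R[i]]_2 :=
  if [pick k : 'I_n | g == (a ^+ k)%g] is Some k then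
    mx2 (omega n ^+ (h * k)) 0 0 (omega n ^- (h * k))
  else if [pick k : 'I_n | g == (b * a ^+ k)%g] is Some k then
    mx2 0 (omega n ^- (h * k)) (omega n ^+ (h * k)) 0
  else 0.

(* V_(rho_h), with functions on D_n written as column vectors *)
Definition rho_space (gT : finGroupType) (n : nat) (a b : gT) (h : nat) :
    {vspace 'cV[R[i]]_(n + n)} :=
  <<[seq \col_i rho n a b h (dihedral_elt a b i) p q
      | p <- enum 'I_2, q <- enum 'I_2]>>%VS.

Definition omega_row (n h : nat) : 'rV[R[i]]_n := \row_k omega n ^+ (h * k).

Definition omegaV_row (n h : nat) : 'rV[R[i]]_n := \row_k omega n ^- (h * k).

Definition unit_norm (m : nat) (v : 'cV[R[i]]_m) : Prop :=
  \sum_i `|v i 0| ^+ 2 = 1.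

End Complex.

Section LinearAlgebra.
Variable F : fieldType.

Definition mx_end (m : nat) (A : 'M[F]_m) : 'End('cV[F]_m) := linfun (mulmx A).

(* The restriction of f to V; it is so only when V is stable under f. *)
Definition restr_end (vT : vectType F) (f : 'End(vT)) (V : {vspace vT}) :
    'End(subvs_of V) :=
  linfun (fun u : subvs_of V => vsproj V (f (vsval u))).

Definition char_poly_end (vT : vectType F) (f : 'End(vT)) : {poly F} :=
  char_poly (passmx.mxof (vbasis fullv) (vbasis fullv) f).

Definition eigenspace_in (vT : vectType F) (f : 'End(vT)) (V : {vspace vT})
    (x : F) : {vspace vT} :=
  (V :&: passmx.leigenspace f x)%VS.

End LinearAlgebra.

(* Main.v *)
Require Import Defs.
From HB Require Import structures.
From mathcomp Require Import all_boot all_order all_algebra.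
From mathcomp Require Import all_fingroup all_solvable.
From mathcomp Require Import complex.
From mathcomp Require Import reals trigo.
From mathcomp Require Import ring.

(** The matrix coefficients of rho_h are, up to order, the four vectors (w, 0),
    (0, w), (w', 0), (0, w'), where w = (z^k)_k and w' = (z^-k)_k for
    z = omega^h.  Call (x w, y w) the wave of ratio z and amplitudes (x, y).

    Left translation by a rotation preserves both blocks of coordinates and
    multiplies each half of a wave by a power of z; left translation by a
    reflection does the same while exchanging the blocks.  Hence A preserves the waves of ratio z and acts on their amplitudes through
    the 2 x 2 matrix with rows (eta1, eta2) and (eta2V, eta1)
    ([adjacency_wave]).  On waves of ratio z^-1 the roles of eta2 and eta2V are
    exchanged, while eta1 is unchanged because S is closed under inversion
    ([mx_end_waveV]).  The theorem is thus about two 2 x 2 matrices, each with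
    eigenvalues eta1 +- sqrt (eta2 * eta2V).

    If eta2 = 0 then eta2V, its conjugate, vanishes too, and A is scalar on
    their span.  Otherwise l has modulus 1, so that conj l = 1 / l, and the
    listed vectors satisfy the eigenvector equations by a direct computation
    ([mx_end_wave_eigen]).  In both cases one gets four eigenvectors.  They form
    a basis because z^2 <> 1, which separates the ratios z and z^-1
    ([free_waves]), and because the two amplitude vectors used for each ratio
    are independent ([wave_span]).  A basis of eigenvectors determines the
    characteristic polynomial, the eigenvalues and the eigenspaces of the
    restriction ([restr_eigenvalues]). *)

Set Implicit Arguments.
Unset Strict Implicit.
Unset Printing Implicit Defensive.

Import Order.TTheory GRing.Theory Num.Theory.
Import passmx.
Local Open Scope ring_scope.

(** * Endomorphisms with a basis of eigenvectors *)

Lemma char_poly_conj (F : fieldType) (n : nat) (P A B : 'M[F]_n) :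
  P \in unitmx -> P *m A = B *m P -> char_poly A = char_poly B.
Proof.
move=> Punit PA; have detP : (\det P)%:P != 0 :> {poly F}.
  by rewrite polyC_eq0 -unitfE -unitmxE.
apply: (mulfI detP); rewrite mulrC [RHS]mulrC /char_poly -!det_map_mx.
rewrite mulrC -!det_mulmx /char_poly_mx mulmxBr mulmxBl -!map_mxM PA.
by rewrite scalar_mxC.
Qed.

Lemma char_poly_end_root (F : fieldType) (vT : vectType F) (g : 'End(vT))
  (x : F) : passmx.leigenvalue g x = root (char_poly_end g) x.
Proof.
rewrite /char_poly_end -eigenvalue_root_char /passmx.leigenvalue.
by rewrite (passmx.leigenspaceE (vbasisP _)) passmx.vsof_eq0 // vbasisP.
Qed.

(** [char_poly_end] is computed in an unspecified basis; the matrix P of the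
    coordinates of the eigenvectors in that basis conjugates it to a diagonal
    matrix. *)
Lemma char_poly_end_diag (F : fieldType) (vT : vectType F) (g : 'End(vT))
    (X : seq vT) (mu : seq F) :
  basis_of fullv X -> size mu = size X ->
  (forall i, (i < size X)%N -> g X`_i = mu`_i *: X`_i) ->
  char_poly_end g = \prod_(x <- mu) ('X - x%:P).
Proof.
move=> bX szmu gX; have szX : size X == \dim {:vT}.
  by rewrite (size_basis (X := in_tuple X)) //= -dimvf.
set e : _.-tuple vT := vbasis fullv; have be : basis_of fullv e := vbasisP _.
pose P := \matrix_(i < \dim {:vT}) passmx.rVof e X`_i.
pose D : 'rV[F]_(\dim {:vT}) := \row_i mu`_i.
have Punit : P \in unitmx.
  rewrite -row_free_unit -kermx_eq0; apply/rowV0P => c /sub_kermxP cP0.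
  have : \sum_(i < \dim {:vT}) c 0 i *: (Tuple szX)`_i = 0.
    apply/eqP; rewrite -(passmx.rVof_eq0 be) linear_sum /=.
    apply/eqP; rewrite -[RHS]cP0 mulmx_sum_row; apply: eq_bigr => i _.
    by rewrite linearZ rowK.
  move/freeP: (basis_free (bX : basis_of _ (Tuple szX))) => freeX.
  by move/freeX => c0; apply/rowP=> i; rewrite c0 mxE.
rewrite /char_poly_end (@char_poly_conj _ _ P _ (diag_mx D) Punit); last first.
  apply/row_matrixP => i; rewrite !row_mul rowK row_diag_mx -scalemxAl -rowE.
  rewrite rowK passmx.mul_mxof passmx.rVofK // gX ?(eqP szX) //.
  by rewrite linearZ mxE.
rewrite char_poly_trig ?diag_mx_is_trig // (big_nth 0) szmu (eqP szX) big_mkord.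
by apply: eq_bigr => i _; rewrite !mxE eqxx.
Qed.

(** The vectors of X, seen in the space V itself, are eigenvectors of the
    restriction of f, so [char_poly_end_diag] applies there. *)
Lemma char_poly_restr_diag (F : fieldType) (vT : vectType F) (f : 'End(vT))
    (V : {vspace vT}) (X : seq vT) (mu : seq F) :
  basis_of V X -> size mu = size X ->
  (forall i, (i < size X)%N -> f X`_i = mu`_i *: X`_i) ->
  char_poly_end (restr_end f V) = \prod_(x <- mu) ('X - x%:P).
Proof.
move=> bX szmu fX; have XV v : v \in X -> v \in V := @basis_mem _ _ _ _ _ bX.
have projK v : v \in V -> linfun (vsproj V) v = vsproj V v by rewrite lfunE.
apply: (@char_poly_end_diag _ _ _ (map (vsproj V) X)); rewrite ?size_map //.
  have -> : map (vsproj V) X = map (linfun (vsproj V)) X.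
    by apply: eq_map => v; rewrite lfunE.
  have -> : fullv = (linfun (vsproj V) @: V)%VS.
    apply/esym/vspaceP => w; rewrite memvf -[w]vsvalK -projK ?subvsP //.
    by rewrite memv_img ?subvsP.
  apply: limg_basis_of bX; apply/eqP; rewrite -subv0; apply/subvP => v.
  rewrite memv_cap memv_ker lfunE memv0 /= => /andP[vV /eqP v0].
  by rewrite -(vsprojK vV) v0.
have restrE : restr_end f V = linfun (vsproj V \o (f \o vsval)) by [].
move=> i ltiX; have Xi := XV _ (mem_nth 0 ltiX).
by rewrite (nth_map 0) // restrE lfunE /= vsprojK // fX // linearZ.
Qed.

(** If v1 + v2, with vi in Ui, is an eigenvector for x, then (y - x) v2 = 0. *)
Lemma eigenspace_in_add (F : fieldType) (vT : vectType F) (f : 'End(vT))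
    (U1 U2 : {vspace vT}) (x y : F) :
  (forall v, v \in U1 -> f v = x *: v) -> (forall v, v \in U2 -> f v = y *: v) ->
  x != y -> eigenspace_in f (U1 + U2) x = U1.
Proof.
move=> f1 f2 neq_xy; apply/vspaceP => v; rewrite memv_cap memv_ker.
rewrite !lfun_simp subr_eq0; apply/idP/idP => [|v1]; last first.
  by rewrite f1 // eqxx (subvP (addvSl U1 U2)).
case/andP=> /memv_addP[v1 v1U [v2 v2U ->]].
rewrite linearD /= f1 // f2 // scalerDr (inj_eq (addrI _)) -subr_eq0 -scalerBl.
by rewrite scaler_eq0 subr_eq0 eq_sym (negbTE neq_xy) => /eqP ->; rewrite addr0.
Qed.

(** All the spectral claims follow from four eigenvectors forming a basis.  When
    x = y the eigenspace is V; the order of the spanning list there is the one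
    that suits the four waves, two of each ratio. *)
Lemma restr_eigenvalues (F : fieldType) (vT : vectType F) (f : 'End(vT))
    (V : {vspace vT}) (v1 v2 v3 v4 : vT) (x y : F) :
  basis_of V [:: v1; v2; v3; v4] ->
  f v1 = x *: v1 -> f v2 = x *: v2 -> f v3 = y *: v3 -> f v4 = y *: v4 ->
  [/\ (f @: V <= V)%VS,
      char_poly_end (restr_end f V) = ('X - x%:P) ^+ 2 * ('X - y%:P) ^+ 2,
      forall u, leigenvalue (restr_end f V) u <-> u = x \/ u = y &
      if x == y then eigenspace_in f V x = <<[:: v1; v3; v2; v4]>>%VS
      else eigenspace_in f V x = <<[:: v1; v2]>>%VS /\
           eigenspace_in f V y = <<[:: v3; v4]>>%VS].
Proof.
move=> bV f1 f2 f3 f4; have charE : char_poly_end (restr_end f V) =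
    ('X - x%:P) ^+ 2 * ('X - y%:P) ^+ 2.
  rewrite (@char_poly_restr_diag _ _ _ _ _ [:: x; x; y; y] bV) //.
    by rewrite !big_cons big_nil mulr1 !expr2 !mulrA.
  by case=> [|[|[|[|]]]].
have spanV : V = (<<[:: v1; v2]>> + <<[:: v3; v4]>>)%VS.
  by rewrite -span_cat (span_basis bV).
have eig (u1 u2 : vT) (r : F) : f u1 = r *: u1 -> f u2 = r *: u2 ->
    forall v, v \in <<[:: u1; u2]>>%VS -> f v = r *: v.
  move=> fu1 fu2 v; rewrite span_cons span_seq1.
  case/memv_addP=> _ /vlineP[c1 ->] [_ /vlineP[c2 ->] ->].
  by rewrite linearD !linearZ /= fu1 fu2 scalerDr !scalerA ![r * _]mulrC.
split=> // [|u|].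
- rewrite -{1}(span_basis bV) limg_span; apply/span_subvP => v.
  have inV i : (i < 4)%N -> [:: v1; v2; v3; v4]`_i \in V.
    by move=> i4; rewrite (basis_mem bV) ?mem_nth.
  rewrite !inE => /or4P[] /eqP ->; rewrite ?f1 ?f2 ?f3 ?f4 memvZ //.
  + exact: (inV 0%N).
  + exact: (inV 1%N).
  + exact: (inV 2%N).
  + exact: (inV 3%N).
- rewrite char_poly_end_root charE rootM !root_exp_XsubC //.
  by split=> [/orP[]/eqP->|[]->]; rewrite ?eqxx ?orbT; [left | right | | ].
case: eqP => [eq_xy | /eqP neq_xy].
  have -> : <<[:: v1; v3; v2; v4]>>%VS = V.
    rewrite -(span_basis bV); apply: eq_span => v; rewrite !inE.
    by do ![case: eqP].
  apply/capv_idPl; rewrite {1}spanV -span_cat; apply/span_subvP => v.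
  rewrite memv_ker !lfun_simp subr_eq0 /=.
  by rewrite !inE => /or4P[] /eqP ->; rewrite ?f1 ?f2 ?f3 ?f4 eq_xy.
have neq_yx : y != x by rewrite eq_sym.
rewrite spanV; split; first exact: eigenspace_in_add (eig _ _ _ f1 f2)
  (eig _ _ _ f3 f4) neq_xy.
rewrite addvC; exact: eigenspace_in_add (eig _ _ _ f3 f4) (eig _ _ _ f1 f2) neq_yx.
Qed.

(** * Power sums over subsets of a cyclic group *)

Section CyclicSums.
Variables (F : fieldType) (gT : finGroupType) (a : gT) (n : nat).
Hypothesis an1 : (a ^+ n = 1)%g.

(** Reindex by j = m + k modulo n. *)
Lemma sum_translate (P : pred gT) (z : F) (k : nat) : z ^+ n = 1 ->
  \sum_(j < n | P (a ^+ j * a ^- k)%g) z ^+ j =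
  z ^+ k * \sum_(m < n | P (a ^+ m)%g) z ^+ m.
Proof.
case: n an1 => [|n'] an zn; first by rewrite !big_ord0 mulr0.
rewrite (reindex_inj (addIr (inZp k))) big_distrr /=.
apply: eq_big => [m|m _]; last by rewrite modnDmr expr_mod // addnC exprD.
by rewrite modnDmr expg_mod // expgnDr mulgK.
Qed.

(** Reindex by j = - m modulo n. *)
Lemma sum_reflect (P : pred gT) (z : F) : z ^+ n = 1 ->
  \sum_(j < n | P (a ^- j)%g) z ^+ j =
  \sum_(m < n | P (a ^+ m)%g) z^-1 ^+ m.
Proof.
case: n an1 => [|n'] an zn; first by rewrite !big_ord0.
rewrite (reindex_inj oppr_inj) /=; apply: eq_big => [m|m _].
  rewrite expg_mod // (_ : _ ^- _ = a ^+ m)%g //.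
  by apply/eqP; rewrite eq_invg_mul -expgnDr subnK ?an // ltnW.
have z0 : z != 0 by rewrite -unitfE; apply/unitrPr; exists (z ^+ n'); rewrite -exprS.
rewrite expr_mod // exprVn; apply: (mulIf (expf_neq0 m z0)).
by rewrite -exprD subnK ?zn 1?ltnW // mulVf // expf_neq0.
Qed.

(** For z = omega^h this is eta_h(C). *)
Definition cyclic_sum (z : F) (C : {set gT}) : F :=
  \sum_(k < n | (a ^+ k)%g \in C) z ^+ k.

Lemma cyclic_sumV (z : F) (C : {set gT}) : z ^+ n = 1 ->
  cyclic_sum z C^-1%g = cyclic_sum z^-1 C.
Proof.
move=> zn; rewrite /cyclic_sum -(@sum_reflect (fun g => g \in C)) //.
by apply: eq_bigl => k; rewrite inE.
Qed.
End CyclicSums.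

(** * Waves *)

Section Waves.
Variables (F : fieldType) (n : nat).

(** A geometric progression of ratio z on each of the two blocks of
    coordinates (rotations, reflections), with amplitudes x and y. *)
Definition wave (z x y : F) : 'cV[F]_(n + n) :=
  (row_mx (x *: \row_(k < n) z ^+ k) (y *: \row_(k < n) z ^+ k))^T.

Lemma wave_l (z x y : F) (k : 'I_n) : wave z x y (lshift n k) 0 = x * z ^+ k.
Proof. by rewrite mxE row_mxEl !mxE. Qed.

Lemma wave_r (z x y : F) (k : 'I_n) : wave z x y (rshift n k) 0 = y * z ^+ k.
Proof. by rewrite mxE row_mxEr !mxE. Qed.

Lemma waveZ (z c x y : F) : c *: wave z x y = wave z (c * x) (c * y).
Proof.
by apply/colP => i; rewrite -(splitK i) mxE; case: (split i) => k /=;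
  rewrite ?wave_l ?wave_r mulrA.
Qed.

Lemma waveD (z x y x' y' : F) :
  wave z x y + wave z x' y' = wave z (x + x') (y + y').
Proof.
by apply/colP => i; rewrite -(splitK i) mxE; case: (split i) => k /=;
  rewrite ?wave_l ?wave_r mulrDl.
Qed.

(** Cramer's rule on the amplitudes. *)
Lemma wave_span (z x1 y1 x2 y2 : F) : x1 * y2 - x2 * y1 != 0 ->
  <<[:: wave z x1 y1; wave z x2 y2]>>%VS =
  <<[:: wave z 1 0; wave z 0 1]>>%VS.
Proof.
move=> det; have mem_w x y (X : seq 'cV[F]_(n + n)) :
    wave z 1 0 \in <<X>>%VS -> wave z 0 1 \in <<X>>%VS ->
    wave z x y \in <<X>>%VS.
  move=> e1 e2; suff -> : wave z x y = x *: wave z 1 0 + y *: wave z 0 1.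
    by rewrite memvD // memvZ.
  by rewrite !waveZ waveD !mulr1 !mulr0 addr0 add0r.
apply/eqP; rewrite eqEsubv; apply/andP; split; apply/span_subvP => v.
  by rewrite !inE => /pred2P[] ->; apply: mem_w; rewrite memv_span ?inE ?eqxx ?orbT.
have memX i : (i < 2)%N -> [:: wave z x1 y1; wave z x2 y2]`_i \in
    <<[:: wave z x1 y1; wave z x2 y2]>>%VS.
  by move=> i2; rewrite memv_span ?mem_nth.
rewrite !inE => /pred2P[] ->.
  suff -> : wave z 1 0 = (x1 * y2 - x2 * y1)^-1 *:
      (y2 *: wave z x1 y1 + (- y1) *: wave z x2 y2).
    by rewrite memvZ // memvD // memvZ // (memX 0%N, memX 1%N).
  by rewrite !waveZ waveD waveZ; congr (wave _ _ _); field.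
suff -> : wave z 0 1 = (x1 * y2 - x2 * y1)^-1 *:
    ((- x2) *: wave z x1 y1 + x1 *: wave z x2 y2).
  by rewrite memvZ // memvD // memvZ // (memX 0%N, memX 1%N).
by rewrite !waveZ waveD waveZ; congr (wave _ _ _); field.
Qed.

(** The blocks do not interact, so only the independence of (z^k) and (z^-k) on
    one block is at stake. *)
Lemma free_waves (z : F) : (1 < n)%N -> z != 0 -> z ^+ 2 != 1 ->
  free [:: wave z 1 0; wave z^-1 0 1; wave z 0 1; wave z^-1 1 0].
Proof.
move=> n_gt1 z0 z2.
(* The values at k = 0 and k = 1 already separate z^k from z^-k. *)
have sep (u v : F) (n0 := Ordinal (ltnW n_gt1)) (n1 := Ordinal n_gt1) :
    (forall k : 'I_n, u * z ^+ k + v * z^-1 ^+ k = 0) -> u = 0 /\ v = 0.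
  move=> uv; have := uv n0; rewrite !expr0 !mulr1 => /eqP.
  rewrite addr_eq0 => /eqP u_v.
  have := uv n1; rewrite u_v !expr1 mulNr addrC -mulrBr => /eqP; rewrite mulf_eq0.
  case/orP => [/eqP -> | ]; first by rewrite oppr0.
  rewrite subr_eq0 => /eqP zV; case/eqP: z2.
  by rewrite expr2 -{1}zV mulVf.
apply/(@freeP _ _ _ [tuple wave z 1 0; wave z^-1 0 1;
                           wave z 0 1; wave z^-1 1 0]) => c.
rewrite !big_ord_recl big_ord0 /= !waveZ addr0 => /colP c0.
have addE (u v : 'cV[F]_(n + n)) i : (u + v) i 0 = u i 0 + v i 0 by rewrite mxE.
have [|c1 c4] := sep (c ord0) (c (lift ord0 (lift ord0 (lift ord0 ord0)))).
  move=> k; have := c0 (lshift n k).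
  by rewrite !addE !wave_l [RHS]mxE !mulr0 !mulr1 !mul0r !add0r.
have [|c3 c2] := sep (c (lift ord0 (lift ord0 ord0))) (c (lift ord0 ord0)).
  move=> k; have := c0 (rshift n k); rewrite !addE !wave_r [RHS]mxE.
  by rewrite !mulr0 !mulr1 !mul0r addr0 add0r addrC.
move=> i; case: (unliftP ord0 i) => [{}i|] -> //.
case: (unliftP ord0 i) => [{}i|] -> //.
case: (unliftP ord0 i) => [{}i|] -> //.
by rewrite ord1.
Qed.

Lemma span_waves (z x1 y1 x2 y2 x3 y3 x4 y4 : F) :
  x1 * y3 - x3 * y1 != 0 -> x2 * y4 - x4 * y2 != 0 ->
  <<[:: wave z x1 y1; wave z^-1 x2 y2; wave z x3 y3; wave z^-1 x4 y4]>>%VS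
  = (<<[:: wave z 1 0; wave z 0 1]>> +
     <<[:: wave z^-1 1 0; wave z^-1 0 1]>>)%VS.
Proof.
move=> det13 det24; rewrite -(wave_span _ det13) -(wave_span _ det24) -span_cat.
by apply: eq_span => v; rewrite !inE; do ![case: eqP].
Qed.

(** The four waves span the same space as the free family of [free_waves], and
    four spanning vectors of a space of dimension 4 form a basis. *)
Lemma basis_waves (z x1 y1 x2 y2 x3 y3 x4 y4 : F) :
  (1 < n)%N -> z != 0 -> z ^+ 2 != 1 ->
  x1 * y3 - x3 * y1 != 0 -> x2 * y4 - x4 * y2 != 0 ->
  basis_of
    <<[:: wave z 1 0; wave z^-1 0 1; wave z 0 1; wave z^-1 1 0]>>%VS
    [:: wave z x1 y1; wave z^-1 x2 y2; wave z x3 y3; wave z^-1 x4 y4].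
Proof.
move=> n_gt1 z0 z2 det13 det24; have /eqP dim4 := free_waves n_gt1 z0 z2.
rewrite basisEdim dim4 leqnn andbT !span_waves //.
  by rewrite mulr1 mulr0 subr0 oner_eq0.
by rewrite mulr1 mulr0 sub0r oppr_eq0 oner_eq0.
Qed.
End Waves.

(** * The adjacency matrix on waves *)

Section Dihedral.
Variables (F : fieldType) (gT : finGroupType) (n : nat) (a b : gT).
Hypotheses (an1 : (a ^+ n = 1)%g) (b2 : (b ^+ 2 = 1)%g).
Hypothesis bab : (b * a * b = a^-1)%g.

Lemma dihedral_elt_l (k : 'I_n) : dihedral_elt a b (lshift n k) = (a ^+ k)%g.
Proof. by rewrite /dihedral_elt (unsplitK (inl k)). Qed.

Lemma dihedral_elt_r (k : 'I_n) :
  dihedral_elt a b (rshift n k) = (b * a ^+ k)%g.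
Proof. by rewrite /dihedral_elt (unsplitK (inr k)). Qed.

Lemma invol_b : (b^-1 = b)%g.
Proof. by apply/eqP; rewrite eq_invg_mul -expg2 b2. Qed.

Lemma mem_rot_part (S : {set gT}) (k : nat) :
  ((a ^+ k)%g \in rot_part a S) = ((a ^+ k)%g \in S).
Proof. by rewrite inE mem_cycle andbT. Qed.

Lemma mem_refl_part (S : {set gT}) (k : nat) :
  ((a ^+ k)%g \in refl_part a b S) = ((b * a ^+ k)%g \in S).
Proof. by rewrite inE mem_cycle andbT mem_lcoset invol_b. Qed.

Lemma conj_expg_b (k : nat) : (b * a ^+ k * b = a ^- k)%g.
Proof.
by rewrite -{1}invol_b -mulgA -conjgE conjXg conjgE invol_b mulgA bab expgVn.
Qed.

Variable S : {set gT}.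
Hypothesis SV : S = S^-1%g.

(** Row g of the product sums over the vertices u with g u^-1 in S.  Writing g
    and u as a^k or b a^k, the relation b a^k b = a^-k and S = S^-1 turn the
    condition into one on a^j a^-k or on its inverse, and [sum_translate] and
    [sum_reflect] extract the factor z^k. *)
Lemma adjacency_wave (z x y : F) : z ^+ n = 1 ->
  let eta1 := cyclic_sum a n z (rot_part a S) in
  let eta2 := cyclic_sum a n z (refl_part a b S) in
  let eta2V := cyclic_sum a n z (refl_part a b S)^-1%g in
  adjacency_mx F (dihedral_elt (n := n) a b) (cayley_rel S) *m wave n z x y =
  wave n z (eta1 * x + eta2 * y) (eta2V * x + eta1 * y).
Proof.
move=> zn /=; have inS g : (g^-1 \in S)%g = (g \in S).
  by rewrite [in LHS]SV inE invgK.
have adjE i : (adjacency_mx F (dihedral_elt (n := n) a b) (cayley_rel S) *m wave n z x y) i 0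
   = x * \sum_(j < n | (dihedral_elt a b i * a ^- j)%g \in S) z ^+ j
   + y * \sum_(j < n | (dihedral_elt a b i * (b * a ^+ j)^-1)%g \in S) z ^+ j.
  rewrite mxE big_split_ord /= !big_distrr /=; congr (_ + _);
    rewrite [RHS]big_mkcond; apply: eq_bigr => j _; rewrite mxE.
    rewrite dihedral_elt_l wave_l /cayley_rel.
    by case: ifP => _; rewrite ?mul1r ?mul0r.
  rewrite dihedral_elt_r wave_r /cayley_rel.
  by case: ifP => _; rewrite ?mul1r ?mul0r.
have rotE : cyclic_sum a n z (rot_part a S) =
    \sum_(k < n | (a ^+ k)%g \in S) z ^+ k.
  by apply: eq_bigl => k; rewrite mem_rot_part.
have reflE u : cyclic_sum a n u (refl_part a b S) =
    \sum_(k < n | (b * a ^+ k)%g \in S) u ^+ k.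
  by apply: eq_bigl => k; rewrite mem_refl_part.
apply/colP => i; rewrite adjE -(splitK i); case: (split i) => k /=.
  rewrite dihedral_elt_l wave_l mulrDl.
  rewrite -[_ * x * _]mulrA -[_ * y * _]mulrA mulrCA [_ * (y * _)]mulrCA.
  congr (_ * _ + _ * _); rewrite mulrC.
    rewrite rotE -(sum_translate an1 (fun g => g \in S)) //.
    by apply: eq_bigl => j; rewrite -inS invMg invgK.
  rewrite reflE -(sum_translate an1 (fun g => b * g \in S)%g) //.
  by apply: eq_bigl => j; rewrite -inS !invMg !invgK mulgA.
rewrite dihedral_elt_r wave_r mulrDl.
rewrite -[_ * x * _]mulrA -[_ * y * _]mulrA mulrCA [_ * (y * _)]mulrCA.
congr (_ * _ + _ * _); rewrite mulrC.
  rewrite cyclic_sumV // reflE -(sum_reflect an1 (fun g => b * g \in S)%g) //.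
  rewrite -(sum_translate an1 (fun g => b * g^-1 \in S)%g) //.
  by apply: eq_bigl => j; rewrite invMg invgK mulgA.
rewrite rotE -(sum_translate an1 (fun g => g \in S)) //.
apply: eq_bigl => j; rewrite (commuteV (commuteX2 j k (commute_refl a))).
congr (_ \in S); rewrite -(conj_expg_b k) -{2}[(a ^+ j)%g]invgK -(conj_expg_b j).
by rewrite !invMg invol_b !mulgA -[(_ * b * b)%g]mulgA -expg2 b2 mulg1.
Qed.

Variable z : F.
Hypothesis zn : z ^+ n = 1.
Let eta1 := cyclic_sum a n z (rot_part a S).
Let eta2 := cyclic_sum a n z (refl_part a b S).
Let eta2V := cyclic_sum a n z (refl_part a b S)^-1%g.
Let f := mx_end (adjacency_mx F (dihedral_elt (n := n) a b) (cayley_rel S)).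

Lemma mx_end_wave (x y : F) :
  f (wave n z x y) = wave n z (eta1 * x + eta2 * y) (eta2V * x + eta1 * y).
Proof. by rewrite lfunE /= adjacency_wave. Qed.

(** Replacing z by its inverse amounts to inverting the subsets of <a>; this
    exchanges eta2 and eta2V and fixes eta1. *)
Lemma mx_end_waveV (x y : F) :
  f (wave n z^-1 x y) = wave n z^-1 (eta1 * x + eta2V * y) (eta2 * x + eta1 * y).
Proof.
have zVn : z^-1 ^+ n = 1 by rewrite exprVn zn invr1.
rewrite lfunE /= adjacency_wave // (cyclic_sumV an1 _ zVn) invrK.
rewrite -!(cyclic_sumV an1 _ zn); congr (wave _ _ (_ * _ + _) (_ + _ * _));
  by congr cyclic_sum; rewrite /rot_part invIg -SV invGid.
Qed.

(** The amplitudes are those of the theorem with conj l written as 1 / l, which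
    makes the four equations purely algebraic consequences of
    eta2V = l^2 eta2. *)
Lemma mx_end_wave_eigen (l c : F) : l != 0 -> eta2V = l ^+ 2 * eta2 ->
  [/\ f (wave n z (c / l) c) = (eta1 + l * eta2) *: wave n z (c / l) c,
      f (wave n z^-1 c (c / l)) = (eta1 + l * eta2) *: wave n z^-1 c (c / l),
      f (wave n z (- c) (c * l)) = (eta1 - l * eta2) *: wave n z (- c) (c * l) &
      f (wave n z^-1 (c * l) (- c)) =
        (eta1 - l * eta2) *: wave n z^-1 (c * l) (- c)].
Proof.
move=> l0 e2V; rewrite !mx_end_wave !mx_end_waveV e2V.
by rewrite !waveZ; split; congr (wave _ _ _ _); field.
Qed.
End Dihedral.

(** * The space of matrix coefficients of rho_h *)

(** Since G = <a><b>, the product formula 2n |<a> :&: <b>| = |<a>| |<b>|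
    with |<a>| <= n and |<b>| <= 2 leaves no room. *)
Lemma dihedral_generators_order (n : nat) (a b : 'D_(n.*2)) :
  (1 < n)%N -> dihedral_generators a b -> #[a]%g = n /\ b \notin <[a]>%g.
Proof.
move=> n_gt1 [gen an b2 bab].
have bV := invol_b b2.
have nab : (<[b]> \subset 'N(<[a]>))%g.
  rewrite cycle_subG inE -cycleJ conjgE bV mulgA bab.
  by rewrite cycle_subG groupV cycle_id.
have prod : (#[a]%g * #[b]%g = n.*2 * #|(<[a]> :&: <[b]>)%g|)%N.
  rewrite /order mul_cardG -norm_joinEr //.
  by rewrite joing_idl joing_idr /joing gen card_dihedral.
have an_le : (#[a]%g <= n)%N by rewrite dvdn_leq ?order_dvdn ?an // ltnW.
have b_le : (#[b]%g <= 2)%N by rewrite dvdn_leq ?order_dvdn ?b2.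
have ab_gt : (0 < #|(<[a]> :&: <[b]>)%g|)%N := cardG_gt0 _.
have a_n : #[a]%g = n.
  apply/eqP; rewrite eqn_leq an_le -(leq_pmul2r (isT : 0 < 2)%N) muln2.
  rewrite (leq_trans (leq_pmulr _ ab_gt)) // -prod leq_mul2l b_le orbT //.
split=> //; apply/negP; rewrite -cycle_subG => /setIidPr ba.
have := leq_mul an_le (leqnn #[b]%g); rewrite prod ba -/(order b).
by rewrite leq_pmul2r ?order_gt0 // -addnn -{3}[n]addn0 leq_add2l leqNgt ltnW.
Qed.

Lemma mx2E (R : realType) (x00 x01 x10 x11 : R[i]) (M := mx2 x00 x01 x10 x11) :
  (M ord0 ord0 = x00) * (M ord0 (lift ord0 ord0) = x01) *
  (M (lift ord0 ord0) ord0 = x10) * (M (lift ord0 ord0) (lift ord0 ord0) = x11).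
Proof.
by rewrite {}/M; do ![split]; rewrite mxE;
  case: splitP => j; rewrite [j]ord1 => //= _; rewrite mxE;
  case: splitP => k; rewrite [k]ord1 => //= _; rewrite mxE eqxx.
Qed.

Section Rho.
Variables (R : realType) (n : nat) (a b : 'D_(n.*2)).
Hypotheses (n_gt1 : (1 < n)%N) (ab_gen : dihedral_generators a b).
Variable h : nat.

Lemma rho_rot (k : 'I_n) : rho R n a b h (a ^+ k)%g =
  mx2 (omega R n ^+ (h * k)) 0 0 (omega R n ^- (h * k)).
Proof.
have [ord_a _] := dihedral_generators_order n_gt1 ab_gen.
rewrite /rho; case: pickP => [k' | /(_ k)]; last by rewrite eqxx.
by rewrite eq_expg_mod_order ord_a !modn_small // => /eqP ->.
Qed.

Lemma rho_refl (k : 'I_n) : rho R n a b h (b * a ^+ k)%g =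
  mx2 0 (omega R n ^- (h * k)) (omega R n ^+ (h * k)) 0.
Proof.
have [ord_a b_a] := dihedral_generators_order n_gt1 ab_gen.
rewrite /rho; case: pickP => [k' /eqP E | _].
  by case/negP: b_a; rewrite -(groupMr _ (mem_cycle a k)) E mem_cycle.
case: pickP => [k' | /(_ k)]; last by rewrite eqxx.
by rewrite (inj_eq (mulgI b)) eq_expg_mod_order ord_a !modn_small // => /eqP ->.
Qed.

Lemma rho_spaceE (z := omega R n ^+ h) : rho_space R n a b h =
  <<[:: wave n z 1 0; wave n z^-1 0 1; wave n z 0 1; wave n z^-1 1 0]>>%VS.
Proof.
rewrite /rho_space !enum_ordSl enum_ord0 /=.
congr <<[:: _; _; _; _]>>%VS; apply/colP => i; rewrite mxE -(splitK i);
  case: (split i) => k /=;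
  rewrite ?dihedral_elt_l ?dihedral_elt_r ?rho_rot ?rho_refl mx2E;
  by rewrite ?wave_l ?wave_r ?mul1r ?mul0r // ?exprVn /z -exprM.
Qed.
End Rho.

(** * The root of unity *)

Section Omega.
Variables (R : realType) (n : nat).

Lemma omegaX (k : nat) : omega R n ^+ k =
  Complex (cos (k%:R * (2 * pi / n%:R))) (sin (k%:R * (2 * pi / n%:R))).
Proof.
elim: k => [|k IHk]; first by rewrite mul0r cos0 sin0.
rewrite exprSr IHk /omega -[k.+1%:R]natr1 [(k%:R + 1) * _]mulrDl mul1r cosD sinD.
by apply/eqP; rewrite eq_complex /= eqxx addrC /= addrC eqxx.
Qed.

Lemma omega_norm : `|omega R n| = 1.
Proof. by rewrite normc_def /= cos2Dsin2 sqrtr1. Qed.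

Lemma omega_unity : (0 < n)%N -> omega R n ^+ n = 1.
Proof.
move=> n_gt0; rewrite omegaX mulrC divfK ?pnatr_eq0 -?lt0n //.
by rewrite mulr_natl cos2pi sin2pi.
Qed.

(** The angle 2 pi h / n lies strictly between 0 and pi, so omega^h is not
    real. *)
Lemma omega_sqr_neq1 (h : nat) : (0 < h)%N -> (h.*2 < n)%N ->
  (omega R n ^+ h) ^+ 2 != 1.
Proof.
move=> h_gt0 lt_hn; have n0 : 0 < n%:R :> R by rewrite ltr0n (leq_trans _ lt_hn).
have: 0 < sin (h%:R * (2 * pi / n%:R)) :> R.
  apply: sin_gt0_pi; rewrite !mulr_gt0 ?ltr0n ?pi_gt0 ?invr_gt0 //=.
  rewrite !mulrA ltr_pdivrMr // [ltRHS]mulrC ltr_pM2r ?pi_gt0 //.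
  by rewrite -natrM muln2 ltr_nat.
rewrite sqrf_eq1 omegaX !eq_complex /= oppr0.
by move=> /gt_eqF ->; rewrite !andbF.
Qed.
End Omega.

(** * Complex waves *)

Section ComplexWaves.
Variables (R : realType) (n : nat).

Lemma unit_norm_wave (z x y : R[i]) : `|z| = 1 ->
  n%:R * (`|x| ^+ 2 + `|y| ^+ 2) = 1 -> unit_norm (wave n z x y).
Proof.
move=> z1; rewrite /unit_norm => <-; rewrite big_split_ord /= mulrDr.
have sumE (c : R[i]) : n%:R * c = \sum_(k < n) c.
  by rewrite sumr_const card_ord mulr_natl.
rewrite !sumE.
by congr (_ + _); apply: eq_bigr => k _;
  rewrite ?wave_l ?wave_r normrM normrX z1 expr1n mulr1.
Qed.

Lemma sqr_norm_sqrtCV (m : nat) : `|(sqrtC m%:R : R[i])^-1| ^+ 2 = m%:R^-1.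
Proof. by rewrite normfV ger0_norm ?sqrtC_ge0 ?ler0n // exprVn sqrtCK. Qed.

Lemma invr_norm1 (x : R[i]) : `|x| = 1 -> x^-1 = x^*.
Proof. by move=> x1; rewrite invC_norm x1 expr1n invr1 mul1r. Qed.

Lemma cyclic_sum_conj (gT : finGroupType) (a : gT) (z : R[i]) (A : {set gT}) :
  `|z| = 1 -> cyclic_sum a n z^-1 A = (cyclic_sum a n z A)^*.
Proof.
move=> z1; rewrite invr_norm1 // rmorph_sum; apply: eq_bigr => k _.
by rewrite rmorphXn.
Qed.

Lemma eta_sumE (gT : finGroupType) (a : gT) (h : nat) (A : {set gT}) :
  eta_sum R n a h A = cyclic_sum a n (omega R n ^+ h) A.
Proof. by apply: eq_bigr => k _; rewrite exprM. Qed.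

Lemma omega_row_wave (h : nat) (c x y : R[i]) :
  c *: (row_mx (x *: omega_row R n h) (y *: omega_row R n h))^T
    = wave n (omega R n ^+ h) (c * x) (c * y).
Proof.
rewrite -waveZ /wave; suff -> : omega_row R n h = \row_k (omega R n ^+ h) ^+ k by [].
by apply/rowP => k; rewrite !mxE exprM.
Qed.

Lemma omegaV_row_wave (h : nat) (c x y : R[i]) :
  c *: (row_mx (x *: omegaV_row R n h) (y *: omegaV_row R n h))^T
    = wave n (omega R n ^+ h)^-1 (c * x) (c * y).
Proof.
rewrite -waveZ /wave; suff -> : omegaV_row R n h = \row_k (omega R n ^+ h)^-1 ^+ k by [].
by apply/rowP => k; rewrite !mxE exprVn -exprM.
Qed.
End ComplexWaves.

(** * Eigenvalues and eigenvectors attached to rho_h *)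

Theorem theorem3p7 (R : realType) (n : nat) (n_ge2 : (2 <= n)%N)
  (a b : 'D_(n.*2)) (ab_gen : dihedral_generators a b)
  (S : {set 'D_(n.*2)}) (S_neq0 : S != set0) (S_not1 : (1%g : 'D_(n.*2)) \notin S)
  (S_inv : S = (S^-1)%g)
  (h : nat) (h_ge1 : (1 <= h)%N) (h_le : (h <= (n - 1) %/ 2)%N) :
  let A : 'M[R[i]]_(n + n) := adjacency_mx _ (dihedral_elt a b) (cayley_rel S) in
  let f := mx_end A in
  let V := rho_space R n a b h in
  let eta1 := eta_sum R n a h (rot_part a S) in
  let eta2 := eta_sum R n a h (refl_part a b S) in
  let eta2V := eta_sum R n a h ((refl_part a b S)^-1)%g in
  let lambda1 := eta1 + sqrtC (eta2 * eta2V) in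
  let lambda2 := eta1 - sqrtC (eta2 * eta2V) in
  let w := omega_row R n h in
  let wV := omegaV_row R n h in
  [/\ \dim V = 4%N /\ (f @: V <= V)%VS,
      forall x : R[i], passmx.leigenvalue (restr_end f V) x <->
        x = lambda1 \/ x = lambda2,
      char_poly_end (restr_end f V) =
        ('X - lambda1%:P) ^+ 2 * ('X - lambda2%:P) ^+ 2,
      (eta2 = 0 ->
       let u1 := (sqrtC n%:R)^-1 *: (row_mx w 0)^T in
       let u2 := (sqrtC n%:R)^-1 *: (row_mx 0 w)^T in
       let u3 := (sqrtC n%:R)^-1 *: (row_mx 0 wV)^T in
       let u4 := (sqrtC n%:R)^-1 *: (row_mx wV 0)^T in
       [/\ unit_norm u1, unit_norm u2, unit_norm u3 & unit_norm u4] /\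
       eigenspace_in f V eta1 = <<[:: u1; u2; u3; u4]>>%VS)
    & (eta2 <> 0 ->
       forall l : R[i], l ^+ 2 = eta2V / eta2 ->
         l * eta2 = sqrtC (eta2 * eta2V) ->
       let v1 := (sqrtC (2 * n)%:R)^-1 *: (row_mx (l^* *: w) w)^T in
       let v2 := (sqrtC (2 * n)%:R)^-1 *: (row_mx wV (l^* *: wV))^T in
       let v3 := (sqrtC (2 * n)%:R)^-1 *: (row_mx (- w) (l *: w))^T in
       let v4 := (sqrtC (2 * n)%:R)^-1 *: (row_mx (l *: wV) (- wV))^T in
       [/\ unit_norm v1, unit_norm v2, unit_norm v3 & unit_norm v4] /\
       (eigenspace_in f V lambda1 = <<[:: v1; v2]>>%VS /\
        eigenspace_in f V lambda2 = <<[:: v3; v4]>>%VS))].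
Proof.
move=> A f V eta1 eta2 eta2V lambda1 lambda2 w wV.
have [_ an1 b2 bab] := ab_gen.
pose z := omega R n ^+ h.
have n0 : n%:R != 0 :> R[i] by rewrite pnatr_eq0 -lt0n ltnW.
have zn : z ^+ n = 1 by rewrite -exprM mulnC exprM omega_unity ?expr1n // ltnW.
have z1 : `|z| = 1 by rewrite normrX omega_norm expr1n.
have zV1 : `|z^-1| = 1 by rewrite normfV z1 invr1.
have z_neq0 : z != 0 by rewrite -normr_gt0 z1.
have z2 : z ^+ 2 != 1.
  apply: omega_sqr_neq1 => //; move: h_le; rewrite leq_divRL // muln2 => h_le'.
  by rewrite (leq_ltn_trans h_le') // subn1 ltn_predL ltnW.
have eta1E : eta1 = cyclic_sum a n z (rot_part a S) by exact: eta_sumE.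
have eta2E : eta2 = cyclic_sum a n z (refl_part a b S) by exact: eta_sumE.
have eta2VE : eta2V = cyclic_sum a n z (refl_part a b S)^-1%g by exact: eta_sumE.
have eta2V_conj : eta2V = eta2^*.
  by rewrite eta2VE cyclic_sumV // cyclic_sum_conj // -eta2E.
(* The hypothesis on each ratio is that its two amplitude vectors are
   independent. *)
have basisV x1 y1 x2 y2 x3 y3 x4 y4 :
    x1 * y3 - x3 * y1 != 0 -> x2 * y4 - x4 * y2 != 0 -> basis_of V
    [:: wave n z x1 y1; wave n z^-1 x2 y2; wave n z x3 y3; wave n z^-1 x4 y4].
  by move=> ? ?; rewrite /V rho_spaceE //; apply: basis_waves.
have dimV : \dim V = 4%N.
  apply: (@size_basis _ _ V 4 [tuple wave n z 1 0; wave n z^-1 0 1;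
    wave n z 0 1; wave n z^-1 1 0]); apply: basisV.
    by rewrite mulr1 mulr0 subr0 oner_eq0.
  by rewrite mulr1 mulr0 sub0r oppr_eq0 oner_eq0.
have wE c x y : c *: (row_mx (x *: w) (y *: w))^T = wave n z (c * x) (c * y).
  exact: omega_row_wave.
have wVE c x y :
    c *: (row_mx (x *: wV) (y *: wV))^T = wave n z^-1 (c * x) (c * y).
  exact: omegaV_row_wave.
clearbody w wV.
have [eta2_0 | eta2_neq0] := eqVneq eta2 0.
  have lam1 : lambda1 = eta1 by rewrite /lambda1 eta2_0 mul0r sqrtC0 addr0.
  have lam2 : lambda2 = eta1 by rewrite /lambda2 eta2_0 mul0r sqrtC0 subr0.
  have eta2V_0 : eta2V = 0 by rewrite eta2V_conj eta2_0 conjC0.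
  pose c : R[i] := (sqrtC n%:R)^-1.
  have c0 : c != 0 by rewrite invr_eq0 sqrtC_eq0.
  have basisU : basis_of V
      [:: wave n z c 0; wave n z^-1 0 c; wave n z 0 c; wave n z^-1 c 0].
    by apply: basisV; rewrite ?mul0r ?subr0 ?sub0r ?oppr_eq0 mulf_neq0.
  have fU x y : f (wave n z x y) = eta1 *: wave n z x y.
    rewrite /f mx_end_wave // -eta1E -eta2E -eta2VE eta2_0 eta2V_0 waveZ.
    by rewrite !mul0r addr0 add0r.
  have fUV x y : f (wave n z^-1 x y) = eta1 *: wave n z^-1 x y.
    rewrite /f mx_end_waveV // -eta1E -eta2E -eta2VE eta2_0 eta2V_0 waveZ.
    by rewrite !mul0r addr0 add0r.
  have [stabV charV eigV eigU] :=
    restr_eigenvalues basisU (fU _ _) (fUV _ _) (fU _ _) (fUV _ _).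
  split; rewrite ?lam1 ?lam2 // => _ /=; rewrite -/c.
  have u1E : c *: (row_mx w 0)^T = wave n z c 0.
    by have := wE c 1 0; rewrite scale1r scale0r mulr1 mulr0.
  have u2E : c *: (row_mx 0 w)^T = wave n z 0 c.
    by have := wE c 0 1; rewrite scale1r scale0r mulr1 mulr0.
  have u3E : c *: (row_mx 0 wV)^T = wave n z^-1 0 c.
    by have := wVE c 0 1; rewrite scale1r scale0r mulr1 mulr0.
  have u4E : c *: (row_mx wV 0)^T = wave n z^-1 c 0.
    by have := wVE c 1 0; rewrite scale1r scale0r mulr1 mulr0.
  rewrite u1E u2E u3E u4E.
  have norm_c : n%:R * (`|c| ^+ 2 + `|0 : R[i]| ^+ 2) = 1.
    by rewrite normr0 expr0n addr0 sqr_norm_sqrtCV mulfV.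
  split; first by split; apply: unit_norm_wave; rewrite // addrC.
  by move: eigU; rewrite eqxx.
pose c : R[i] := (sqrtC (2 * n)%:R)^-1.
have n2_neq0 : (2 * n)%:R != 0 :> R[i] by rewrite natrM mulf_neq0 // pnatr_eq0.
have c0 : c != 0 by rewrite invr_eq0 sqrtC_eq0.
have norm_c : n%:R * (`|c| ^+ 2 + `|c| ^+ 2) = 1.
  rewrite sqr_norm_sqrtCV natrM; field.
  exact: n0.
have eta2V_neq0 : eta2V != 0 by rewrite eta2V_conj conjC_eq0.
pose s := sqrtC (eta2 * eta2V).
have s2 : s ^+ 2 = eta2 * eta2V by exact: sqrtCK.
have s0 : s != 0 by rewrite sqrtC_eq0 mulf_neq0.
(* As eta2V is the conjugate of eta2, their quotient has modulus 1. *)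
have norm_l (l : R[i]) : l ^+ 2 = eta2V / eta2 -> `|l| = 1.
  move=> l2; apply/eqP; rewrite -(@pexpr_eq1 _ _ 2) // -normrX l2 eta2V_conj.
  by rewrite normrM normfV norm_conjC divff // normr_eq0.
(* This covers every admissible l; the first three claims, which do not mention
   l, use it with l = s / eta2. *)
have eigen_l (l : R[i]) : l ^+ 2 = eta2V / eta2 -> l * eta2 = s ->
  let V1 := [:: wave n z (c / l) c; wave n z^-1 c (c / l)] in
  let V2 := [:: wave n z (- c) (c * l); wave n z^-1 (c * l) (- c)] in
  [/\ (f @: V <= V)%VS,
      char_poly_end (restr_end f V) =
        ('X - lambda1%:P) ^+ 2 * ('X - lambda2%:P) ^+ 2,
      forall u, leigenvalue (restr_end f V) u <-> u = lambda1 \/ u = lambda2 &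
      if lambda1 == lambda2 then
        eigenspace_in f V lambda1 = <<[:: V1`_0; V2`_0; V1`_1; V2`_1]>>%VS
      else eigenspace_in f V lambda1 = <<V1>>%VS /\
           eigenspace_in f V lambda2 = <<V2>>%VS].
  move=> l2 ls /=; have l0 : l != 0 by rewrite -normr_gt0 norm_l.
  have two0 : (2 : R[i]) != 0 by rewrite pnatr_eq0.
  have [|f1 f2 f3 f4] := mx_end_wave_eigen an1 b2 bab S_inv zn c l0.
    by rewrite -eta2E -eta2VE l2 divfK.
  rewrite -eta1E -eta2E ls in f1 f2 f3 f4.
  apply: restr_eigenvalues f1 f2 f3 f4; apply: basisV.
    suff -> : c / l * (c * l) - - c * c = 2 * c ^+ 2 by rewrite mulf_neq0 ?expf_neq0.
    by field.
  suff -> : c * - c - c * l * (c / l) = - (2 * c ^+ 2).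
    by rewrite oppr_eq0 mulf_neq0 ?expf_neq0.
  by field.
have lam_neq : lambda1 != lambda2.
  rewrite -subr_eq0 (_ : _ - _ = 2 * s); last by rewrite /lambda1 /lambda2 -/s; ring.
  by rewrite mulf_neq0 ?pnatr_eq0.
have [||stabV charV eigV _] := eigen_l (s / eta2).
- by rewrite expr_div_n s2; field.
- by rewrite divfK.
split=> // [/eqP|_ l l2 ls /=]; first by rewrite (negbTE eta2_neq0).
rewrite -/c; have lV := invr_norm1 (norm_l _ l2).
have [_ _ _] := eigen_l l l2 ls; rewrite (negbTE lam_neq).
have v1E : c *: (row_mx (l^* *: w) w)^T = wave n z (c / l) c.
  by have := wE c l^* 1; rewrite scale1r mulr1 lV.
have v2E : c *: (row_mx wV (l^* *: wV))^T = wave n z^-1 c (c / l).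
  by have := wVE c 1 l^*; rewrite scale1r mulr1 lV.
have v3E : c *: (row_mx (- w) (l *: w))^T = wave n z (- c) (c * l).
  by have := wE c (- 1) l; rewrite scaleN1r mulrN1.
have v4E : c *: (row_mx (l *: wV) (- wV))^T = wave n z^-1 (c * l) (- c).
  by have := wVE c l (- 1); rewrite scaleN1r mulrN1.
rewrite v1E v2E v3E v4E => eigE; split; last exact: eigE.
clearbody c.
by split; apply: unit_norm_wave => //;
  rewrite ?normrN normrM ?normfV (norm_l l l2) ?invr1 mulr1.
Qed.
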